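(* The only reversible elements of the braid group $B_3=\langle \sigma_1,\sigma_2\mid \sigma_1\sigma_2\sigma_1=\sigma_2\sigma_1\sigma_2\rangle$ are the conjugates of $[\sigma_1\sigma_2\sigma_1,k]$, for any element $k\in B_3$.
   Context: A non-trivial element $a$ of a group $\Gamma$ is reversible if there is $g\in\Gamma$ with $gag^{-1}=a^{-1}$; only non-trivial elements are considered. Here $[x,y]=xyx^{-1}y^{-1}$. The statement is a classification: the non-trivial elements conjugate to some $[\sigma_1\sigma_2\sigma_1,k]$ are reversible, and there are no others. *)

(* Defs.v *)
From HB Require Import structures.
From mathcomp Require Import all_boot.
From mathcomp Require Import boolp.

Set Implicit Arguments.
Unset Strict Implicit.
Unset Printing Implicit Defensive.

Local Open Scope quotient_scope.

(* The letter (i, e) is the generator sigma_1 (i = false) or sigma_2 (i = true),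
   inverted when e = true. *)
Definition letter : Type := (bool * bool)%type.
Definition word : Type := seq letter.

Definition letter_inv (x : letter) : letter := (x.1, ~~ x.2).
Definition word_inv (u : word) : word := rev (map letter_inv u).

Definition s1 : letter := (false, false).
Definition s2 : letter := (true, false).

Inductive braid_equiv : word -> word -> Prop :=
| braid_refl u : braid_equiv u u
| braid_sym u v : braid_equiv u v -> braid_equiv v u
| braid_trans u v w : braid_equiv u v -> braid_equiv v w -> braid_equiv u w
| braid_cat u u' v v' :
    braid_equiv u u' -> braid_equiv v v' -> braid_equiv (u ++ v) (u' ++ v')
| braid_cancel x : braid_equiv [:: x; letter_inv x] [::]
| braid_rel : braid_equiv [:: s1; s2; s1] [:: s2; s1; s2].

Definition braid_eqb : rel word := fun u v => `[< braid_equiv u v >].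

Lemma braid_eqb_refl : reflexive braid_eqb.
Proof. by move=> u; apply/asboolP; exact: braid_refl. Qed.

Lemma braid_eqb_sym : symmetric braid_eqb.
Proof. by move=> u v; apply/asboolP/asboolP; exact: braid_sym. Qed.

Lemma braid_eqb_trans : transitive braid_eqb.
Proof.
move=> v u w /asboolP uv /asboolP vw.
by apply/asboolP; exact: braid_trans uv vw.
Qed.

Canonical braid_eqb_equiv :=
  EquivRel braid_eqb braid_eqb_refl braid_eqb_sym braid_eqb_trans.

Definition B3 : Type := {eq_quot braid_eqb}.
HB.instance Definition _ := Choice.on B3.
HB.instance Definition _ := EqQuotient.on B3.

Lemma B3_eqP (u v : word) : \pi_B3 u = \pi_B3 v <-> braid_equiv u v.
Proof.
split=> [/eqmodP/asboolP //|uv]; by apply/eqmodP/asboolP.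
Qed.

Lemma letter_invK : involutive letter_inv.
Proof. by case=> i e; rewrite /letter_inv /= negbK. Qed.

Lemma word_invK : involutive word_inv.
Proof.
by move=> u; rewrite /word_inv map_rev revK (mapK letter_invK).
Qed.

Lemma word_inv_cat (u v : word) : word_inv (u ++ v) = word_inv v ++ word_inv u.
Proof. by rewrite /word_inv map_cat rev_cat. Qed.

Lemma braid_mulwV (u : word) : braid_equiv (u ++ word_inv u) [::].
Proof.
elim: u => [|x u IHu]; first exact: braid_refl.
rewrite -cat1s word_inv_cat -catA (catA u).
apply: braid_trans (braid_cancel x).
rewrite -[X in braid_equiv _ X]/([:: x] ++ ([::] ++ [:: letter_inv x])).
by do 2?apply: braid_cat => //; exact: braid_refl.
Qed.

Lemma braid_mulVw (u : word) : braid_equiv (word_inv u ++ u) [::].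
Proof. by have := braid_mulwV (word_inv u); rewrite word_invK. Qed.

Lemma braid_inv (u v : word) :
  braid_equiv u v -> braid_equiv (word_inv u) (word_inv v).
Proof.
move=> uv.
have := braid_cat (braid_refl (word_inv u)) (braid_mulwV v).
rewrite cats0 => /braid_sym /braid_trans; apply.
rewrite catA -[X in braid_equiv _ X]cat0s.
apply: braid_cat; last exact: braid_refl.
apply: braid_trans (braid_mulVw u).
by apply: braid_cat; [exact: braid_refl | exact: braid_sym].
Qed.

Definition B3_one : B3 := \pi_B3 [::].
Definition B3_mul (a b : B3) : B3 := \pi_B3 (repr a ++ repr b).
Definition B3_inv (a : B3) : B3 := \pi_B3 (word_inv (repr a)).

Lemma repr_pi_B3 (u : word) : braid_equiv (repr (\pi_B3 u)) u.
Proof. by apply/B3_eqP; rewrite reprK. Qed.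

Lemma B3_surj (a : B3) : exists u : word, a = \pi_B3 u.
Proof. by exists (repr a); rewrite reprK. Qed.

Lemma B3_mulE (u v : word) : B3_mul (\pi_B3 u) (\pi_B3 v) = \pi_B3 (u ++ v).
Proof. by apply/B3_eqP; apply: braid_cat; exact: repr_pi_B3. Qed.

Lemma B3_invE (u : word) : B3_inv (\pi_B3 u) = \pi_B3 (word_inv u).
Proof. by apply/B3_eqP; apply: braid_inv; exact: repr_pi_B3. Qed.

Lemma B3_mulA : associative B3_mul.
Proof.
move=> a b c; have [u ->] := B3_surj a; have [v ->] := B3_surj b.
have [w ->] := B3_surj c.
by rewrite !B3_mulE catA.
Qed.

Lemma B3_mul1g : left_id B3_one B3_mul.
Proof. by move=> a; have [u ->] := B3_surj a; rewrite B3_mulE. Qed.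

Lemma B3_mulg1 : right_id B3_one B3_mul.
Proof. by move=> a; have [u ->] := B3_surj a; rewrite B3_mulE cats0. Qed.

Lemma B3_mulVg : left_inverse B3_one B3_inv B3_mul.
Proof.
move=> a; have [u ->] := B3_surj a; rewrite B3_invE B3_mulE.
by apply/B3_eqP; exact: braid_mulVw.
Qed.

Lemma B3_mulgV : right_inverse B3_one B3_inv B3_mul.
Proof.
move=> a; have [u ->] := B3_surj a; rewrite B3_invE B3_mulE.
by apply/B3_eqP; exact: braid_mulwV.
Qed.

HB.instance Definition _ :=
  isGroup.Build B3 B3_mulA B3_mul1g B3_mulg1 B3_mulVg B3_mulgV.

Local Open Scope group_scope.

Lemma pi_B3M (u v : word) : (\pi_B3 u : B3) * \pi_B3 v = \pi_B3 (u ++ v).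
Proof. exact: B3_mulE. Qed.

Definition sigma1 : B3 := \pi_B3 [:: s1].
Definition sigma2 : B3 := \pi_B3 [:: s2].

Lemma sigma_braid : sigma1 * sigma2 * sigma1 = sigma2 * sigma1 * sigma2.
Proof.
by rewrite /sigma1 /sigma2 !pi_B3M; apply/B3_eqP; exact: braid_rel.
Qed.

Lemma B3_universal (G : groupType) (x y : G) :
  x * y * x = y * x * y ->
  exists f : B3 -> G,
    [/\ {morph f : a b / a * b}, f sigma1 = x, f sigma2 = y &
      forall g : B3 -> G, {morph g : a b / a * b} ->
        g sigma1 = x -> g sigma2 = y -> g =1 f].
Proof.
move=> xyx.
pose ev1 (l : letter) : G :=
  let z := if l.1 then y else x in if l.2 then z^-1 else z.
pose ev (u : word) : G := foldr (fun l z => ev1 l * z) 1 u.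
have ev_cat u v : ev (u ++ v) = ev u * ev v.
  by elim: u => [|l u IHu] /=; rewrite ?mul1g // IHu mulgA.
have evP u v : braid_equiv u v -> ev u = ev v.
  elim=> {u v} [//|u v _ -> //|u v w _ -> _ -> //|u u' v v' _ eu _ ev'||].
  - by rewrite !ev_cat eu ev'.
  - by case=> [i []]; rewrite /ev /ev1 /= mulg1 (mulVg, mulgV).
  - by rewrite /ev /ev1 /= !mulg1 !mulgA.
exists (fun a => ev (repr a)); split.
- by move=> a b; rewrite -ev_cat; apply: evP; exact: repr_pi_B3.
- by rewrite (evP _ _ (repr_pi_B3 _)) /ev /= mulg1.
- by rewrite (evP _ _ (repr_pi_B3 _)) /ev /= mulg1.
move=> g gM gx gy a; rewrite -{1}[a]reprK; elim: (repr a) => [|[i e] u IHu].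
  by apply: (mulgI (g 1)); rewrite -gM mulg1 mulg1.
have -> : \pi_B3 ((i, e) :: u) = \pi_B3 [:: (i, e)] * \pi_B3 u.
  by rewrite pi_B3M.
have g1 : g 1 = 1 by apply: (mulgI (g 1)); rewrite -gM !mulg1.
have gi : g (\pi_B3 [:: (i, false)]) = (if i then y else x) by case: i.
rewrite gM IHu /= /ev1 /=; congr (_ * _); case: e => //.
apply: (mulgI (if i then y else x)); rewrite mulgV -gi -gM -g1.
by rewrite pi_B3M; congr g; apply/B3_eqP; exact: (braid_cancel (i, false)).
Qed.

(* [x, y] = x y x^-1 y^-1; the library's [~ x, y] is x^-1 y^-1 x y. *)
Definition bracket (G : groupType) (x y : G) : G := x * y * x^-1 * y^-1.

Definition is_conjugate (G : groupType) (x y : G) : Prop :=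
  exists g : G, y = g * x * g^-1.

Definition reversible (G : groupType) (a : G) : Prop :=
  a <> 1 /\ exists g : G, g * a * g^-1 = a^-1.

(* Main.v *)
(** Modulo its centre, generated by [zeta = Delta^2], B_3 is the free product
    Z/2 * Z/3, generated by [Delta] and [eta] with [zeta = eta^3]. So every
    element is conjugate, modulo the centre, to 1, [Delta], [eta], [eta^-1] or a
    nonempty positive word in [sigma1^-1] and [sigma2]. In the representation
    [rho] of B_3 in SL_2(Z) these have, up to sign, trace 2, 0, 1, 1 and at
    least 2, so the elements of trace zero are conjugate to [Delta] modulo the centre.

    If g inverts a, then [rho g]^2 commutes with [rho a]. When [rho g] has
    nonzero trace, Cayley-Hamilton makes [rho g] itself commute with [rho a],
    so [rho a]^2 = 1, and since a has degree 0 this forces a = 1. Hence, up to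
    conjugation, g is [Delta]; then (a Delta)^2 = zeta, so a Delta again has
    trace zero and is a conjugate of [Delta], by degree, whence
    a = k Delta k^-1 Delta^-1 = [Delta, k]^-1. *)
From HB Require Import structures.
Require Import Defs.
From mathcomp Require Import all_boot all_algebra.
From Corelib Require Import Setoid Morphisms.
From mathcomp Require Import zify ring.

Set Implicit Arguments.
Unset Strict Implicit.
Unset Printing Implicit Defensive.

Import GRing.Theory Num.Theory.

Local Open Scope group_scope.

(** * Evaluation of braid words in a monoid, and the degree *)

Section Evaluation.
Variables (T : Type) (idx : T) (op : Monoid.law idx) (f : letter -> T).
Hypothesis fV : forall l, op (f l) (f (letter_inv l)) = idx.
Hypothesis f_braid :
  op (op (f s1) (f s2)) (f s1) = op (op (f s2) (f s1)) (f s2).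

(** A monoid target suffices because letters carry their own inverses; this covers both integers
    under addition and matrices under multiplication. *)
Lemma braid_equiv_big u v :
  braid_equiv u v -> \big[op/idx]_(l <- u) f l = \big[op/idx]_(l <- v) f l.
Proof.
elim=> {u v} [//|u v _ -> //|u v w _ -> _ -> //|u u' v v' _ eu _ ev||].
- by rewrite !big_cat eu ev.
- by move=> l; rewrite !big_cons big_nil Monoid.mulm1 fV.
- by rewrite !big_cons !big_nil !Monoid.mulm1 !Monoid.mulmA.
Qed.

Definition B3_eval (a : B3) : T := \big[op/idx]_(l <- repr a) f l.

Lemma B3_eval_pi u : B3_eval (\pi_B3 u)%qT = \big[op/idx]_(l <- u) f l.
Proof. exact/braid_equiv_big/repr_pi_B3. Qed.

Lemma B3_evalM a b : B3_eval (a * b) = op (B3_eval a) (B3_eval b).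
Proof.
have [u ->] := B3_surj a; have [v ->] := B3_surj b.
by rewrite pi_B3M !B3_eval_pi big_cat.
Qed.

Lemma B3_eval1 : B3_eval 1 = idx.
Proof. by rewrite -[1]/B3_one B3_eval_pi big_nil. Qed.

End Evaluation.

Definition deg_letter (l : letter) : int := ((-1) ^+ l.2)%R.

Definition deg : B3 -> int := B3_eval +%R deg_letter.

Lemma deg_letterV l : (deg_letter l + deg_letter (letter_inv l))%R = 0%R.
Proof. by case: l => i []. Qed.

Lemma deg_pi u : deg (\pi_B3 u)%qT = (\sum_(l <- u) deg_letter l)%R.
Proof. exact: B3_eval_pi deg_letterV _ _. Qed.

Lemma degM a b : deg (a * b) = (deg a + deg b)%R.
Proof. exact: B3_evalM deg_letterV _ _ _. Qed.

Lemma deg1 : deg 1 = 0%R.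
Proof. exact: B3_eval1 deg_letterV _. Qed.

Lemma degV a : deg a^-1 = (- deg a)%R.
Proof. by apply/eqP; rewrite -subr_eq0 opprK -degM mulVg deg1. Qed.

Lemma degX a n : deg (a ^+ n) = (deg a *+ n)%R.
Proof.
by elim: n => [|n IHn]; rewrite ?expg0 ?deg1 // expgS degM IHn mulrS.
Qed.

Lemma degJ a h : deg (a ^ h) = deg a.
Proof. by rewrite conjgE !degM degV; ring. Qed.

(** * Two-by-two matrices and the representation [rho] *)

Lemma mx2P (R : Type) (A B : 'M[R]_2) :
  A 0%R 0%R = B 0%R 0%R -> A 0%R 1%R = B 0%R 1%R ->
  A 1%R 0%R = B 1%R 0%R -> A 1%R 1%R = B 1%R 1%R -> A = B.
Proof.
move=> e00 e01 e10 e11; apply/matrixP=> i j.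
have ord2 (k : 'I_2) : k = 0%R \/ k = 1%R.
  by case: k => [[|[|//]] ?]; [left | right]; apply: val_inj.
by case: (ord2 i) => ->; case: (ord2 j) => ->.
Qed.

Lemma mul_mx2E (R : pzRingType) (A B : 'M[R]_2) i j :
  ((A * B) i j = A i 0 * B 0 j + A i 1 * B 1 j)%R.
Proof.
rewrite -mulmxE mxE !big_ord_recl big_ord0 addr0.
by rewrite (_ : lift ord0 ord0 = 1%R) //; apply: val_inj.
Qed.

Lemma trace_mx2 (R : pzRingType) (A : 'M[R]_2) : (\tr A = A 0 0 + A 1 1)%R.
Proof.
rewrite /mxtrace !big_ord_recl big_ord0 addr0.
by rewrite (_ : lift ord0 ord0 = 1%R) //; apply: val_inj.
Qed.

Lemma det_mx2 (R : comPzRingType) (A : 'M[R]_2) :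
  (\det A = A 0 0 * A 1 1 - A 0 1 * A 1 0)%R.
Proof.
rewrite (expand_det_row A 0%R) !big_ord_recl big_ord0 addr0 /cofactor !det_mx11.
rewrite !mxE /= (_ : lift ord0 ord0 = 1%R); last exact: val_inj.
rewrite (_ : lift 1%R 0%R = 0%R); last exact: val_inj.
by rewrite expr0 expr1 /=; ring.
Qed.

Lemma Cayley_Hamilton2 (R : comPzRingType) (A : 'M[R]_2) :
  (A * A = \tr A *: A - (\det A)%:M)%R.
Proof.
by apply: mx2P; rewrite !mul_mx2E !mxE trace_mx2 det_mx2 /=; ring.
Qed.

(* [sigma1] acts as [[1, -1], [0, 1]] and [sigma2] as [[1, 0], [1, 1]]. *)
Definition rho_letter (l : letter) : 'M[int]_2 :=
  (1 + (-1) ^+ (l.1 == l.2) *: if l.1 then delta_mx 1 0 else delta_mx 0 1)%R.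

Definition rho : B3 -> 'M[int]_2 := B3_eval *%R rho_letter.

Lemma rho_letterV l : (rho_letter l * rho_letter (letter_inv l))%R = 1%R.
Proof.
by case: l => [[] []]; apply: mx2P; rewrite !mul_mx2E !mxE /=.
Qed.

Lemma rho_letter_braid :
  (rho_letter s1 * rho_letter s2 * rho_letter s1 =
   rho_letter s2 * rho_letter s1 * rho_letter s2)%R.
Proof. by apply: mx2P; rewrite !mul_mx2E !mxE /=. Qed.

Lemma rho_pi u : rho (\pi_B3 u)%qT = (\prod_(l <- u) rho_letter l)%R.
Proof. exact: B3_eval_pi rho_letterV rho_letter_braid _. Qed.

Lemma rhoM a b : rho (a * b) = (rho a * rho b)%R.
Proof. exact: B3_evalM rho_letterV rho_letter_braid _ _. Qed.

Lemma rho1 : rho 1 = 1%R.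
Proof. exact: B3_eval1 rho_letterV rho_letter_braid. Qed.

Lemma det_rho a : (\det (rho a) = 1)%R.
Proof.
rewrite /rho /B3_eval; elim: (repr a) => [|l u IHu].
  by rewrite big_nil det1.
rewrite big_cons -mulmxE det_mulmx IHu mulr1 det_mx2 !mxE.
by case: l => [[] []]; rewrite /= !mxE.
Qed.

Lemma B3_ind (K : B3 -> Prop) :
  K 1 -> (forall l a, K a -> K ((\pi_B3 [:: l])%qT * a)) -> forall a, K a.
Proof.
move=> K1 KM a; rewrite -[a]reprK; elim: (repr a) => [|l u IHu] //.
by rewrite -cat1s -pi_B3M; exact: KM.
Qed.

Lemma pi_letter l :
  (\pi_B3 [:: l])%qT =
  (if l.2 then (if l.1 then sigma2 else sigma1)^-1
   else if l.1 then sigma2 else sigma1) :> B3.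
Proof.
by case: l => [[] []] //=; apply/esym; exact: B3_invE.
Qed.

(** * The elements [Delta], [eta] and the central element [zeta] *)

HB.lock Definition Delta : B3 := sigma1 * sigma2 * sigma1.
HB.lock Definition eta : B3 := sigma1 * sigma2.
Definition zeta : B3 := Delta * Delta.

Lemma Delta_eta_sigma1 : Delta = eta * sigma1.
Proof. by rewrite Delta.unlock eta.unlock. Qed.

Lemma Delta_sigma2_eta : Delta = sigma2 * eta.
Proof. by rewrite Delta.unlock eta.unlock sigma_braid mulgA. Qed.

(** Conjugation by [Delta] swaps the two generators, so its square [zeta] is central. *)
Lemma Delta_sigma1 : Delta * sigma1 = sigma2 * Delta.
Proof.
by rewrite Delta_sigma2_eta -mulgA -Delta_eta_sigma1 Delta_sigma2_eta.
Qed.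

Lemma eta_sigma12 : eta = sigma1 * sigma2.
Proof. by rewrite eta.unlock. Qed.

Lemma Delta_sigma2 : Delta * sigma2 = sigma1 * Delta.
Proof.
rewrite {1}Delta_eta_sigma1 Delta_sigma2_eta -mulgA [RHS]mulgA.
by rewrite -eta_sigma12.
Qed.

(** Multiply [Delta = eta * sigma1] by [Delta = sigma2 * eta]: the middle factor is again [eta]. *)
Lemma eta3 : eta * eta * eta = zeta.
Proof.
rewrite /zeta {1}Delta_eta_sigma1 Delta_sigma2_eta -!mulgA; congr (_ * _).
by rewrite {1}eta_sigma12 -mulgA.
Qed.

Lemma deg_Delta : deg Delta = 3%R.
Proof. by rewrite Delta.unlock !degM !deg_pi !big_seq1. Qed.

Lemma deg_eta : deg eta = 2%R.
Proof. by rewrite eta.unlock !degM !deg_pi !big_seq1. Qed.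

Lemma zeta_central a : commute a zeta.
Proof.
have c1 : commute zeta sigma1.
  by rewrite /commute /zeta -mulgA Delta_sigma1 mulgA Delta_sigma2 -mulgA.
have c2 : commute zeta sigma2.
  by rewrite /commute /zeta -mulgA Delta_sigma2 mulgA Delta_sigma1 -mulgA.
apply: commute_sym; elim/B3_ind: a => [|l a za]; first exact: commute1.
apply: commuteM => //; rewrite pi_letter.
by case: l => [[] []] /=; try apply: commuteV.
Qed.

Lemma zetaX_central n a : commute a (zeta ^+ n).
Proof. exact/commuteX/zeta_central. Qed.

(** * Congruence modulo the powers of [zeta] *)

(** Allowing a power of [zeta] on each side gives a symmetric relation with natural exponents
    only. *)
Definition eqz (a b : B3) : Prop :=
  exists m n, a * zeta ^+ m = b * zeta ^+ n.

Lemma eqz_refl : Reflexive eqz.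
Proof. by move=> a; exists 0, 0. Qed.

Lemma eqz_sym : Symmetric eqz.
Proof. by move=> a b [m [n e]]; exists n, m. Qed.

Lemma eqz_trans : Transitive eqz.
Proof.
move=> a b c [m [n e]] [p [q e']]; exists (m + p), (n + q).
rewrite expgnDr mulgA e -mulgA -expgnDr addnC expgnDr mulgA e'.
by rewrite -mulgA -expgnDr addnC.
Qed.

#[local] Instance eqz_equivalence : Equivalence eqz.
Proof. by split; [exact: eqz_refl | exact: eqz_sym | exact: eqz_trans]. Qed.

#[local] Instance eqz_mul : Proper (eqz ==> eqz ==> eqz) (@monoid.mul B3).
Proof.
move=> a a' [m [n e]] b b' [p [q e']]; exists (m + p), (n + q).
have swap c d i j : c * d * zeta ^+ (i + j) = c * zeta ^+ i * (d * zeta ^+ j).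
  by rewrite expgnDr !mulgA -(mulgA c d) (zetaX_central i d) mulgA.
by rewrite !swap e e'.
Qed.

#[local] Instance eqz_inv : Proper (eqz ==> eqz) (@monoid.inv B3).
Proof.
move=> a b [m [n e]]; exists n, m.
rewrite zetaX_central; apply: (mulIg a); rewrite mulgVK; apply: (mulgI b).
by rewrite !mulgA mulgV mul1g -zetaX_central e.
Qed.

Lemma eqz_zeta : eqz zeta 1.
Proof. by exists 0%N, 1%N; rewrite expg0 mulg1 mul1g. Qed.

Lemma eqzJ a b h : eqz a b -> eqz (a ^ h) (b ^ h).
Proof. by rewrite !conjgE => ->; reflexivity. Qed.

Lemma deg_zetaX n : deg (zeta ^+ n) = (n%:Z * 6)%R.
Proof. by rewrite degX degM deg_Delta -[Posz n]natz mulr_natl. Qed.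

Lemma eqz_deg a b : eqz a b -> exists k : int, (deg a = deg b + k * 6)%R.
Proof.
move=> [m [n e]]; exists (n%:Z - m%:Z)%R.
have := congr1 deg e; rewrite !degM !deg_zetaX => e'.
by rewrite mulrBl; lia.
Qed.

(** As [zeta] has degree 6, the degree fixes the power of [zeta] by which congruent elements
    differ. *)
Lemma eqz_eq a b : eqz a b -> deg a = deg b -> a = b.
Proof.
move=> [m [n e]] dab; have := congr1 deg e.
rewrite !degM !deg_zetaX dab => /addrI emn.
have {}emn : m = n by lia.
by move: e; rewrite emn => /mulIg.
Qed.

(** * Normal forms in the free product of Z/2 and Z/3 *)

Definition rot (b : bool) : B3 := if b then eta^-1 else eta.

(* The images under [rho] of [turn false] and [turn true] are the elementary
   matrices with nonnegative entries. *)
Definition turn (b : bool) : B3 := if b then sigma2 else sigma1^-1.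

Lemma Delta2_eqz : eqz (Delta * Delta) 1.
Proof. exact: eqz_zeta. Qed.

Lemma rot2_eqz b : eqz (rot b * rot b) (rot (~~ b)).
Proof.
have e : eqz (eta * eta) eta^-1.
  by rewrite -[X in eqz X _](mulgK eta) eta3 eqz_zeta mul1g; reflexivity.
by case: b => //=; have := eqz_inv e; rewrite invgM invgK.
Qed.

Lemma rotV b : rot b * rot (~~ b) = 1.
Proof. by case: b; rewrite /= ?mulVg ?mulgV. Qed.

Lemma Delta_turn b : eqz (Delta * turn b) (rot b).
Proof.
case: b => /=; last by rewrite Delta_eta_sigma1 mulgK; reflexivity.
have -> : sigma2 = Delta * eta^-1 by rewrite Delta_sigma2_eta mulgK.
by rewrite mulgA Delta2_eqz mul1g; reflexivity.
Qed.

Lemma turn_eqz b : eqz (turn b) (Delta * rot b).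
Proof.
by have := Delta_turn b => <-; rewrite mulgA Delta2_eqz mul1g; reflexivity.
Qed.

Lemma letter_eqz l :
  exists b, eqz (\pi_B3 [:: l])%qT (Delta * rot b) \/
            eqz (\pi_B3 [:: l])%qT (rot b * Delta).
Proof.
have DV : eqz Delta^-1 Delta.
  by rewrite -[X in eqz X _]mul1g -Delta2_eqz mulgK; reflexivity.
have turnV b : eqz (turn b)^-1 (rot (~~ b) * Delta).
  rewrite turn_eqz invgM DV; have <- := mulg1_eq (rotV b); reflexivity.
exists (~~ l.2); rewrite pi_letter; case: l => [[] []] /=.
- by right; exact: (turnV true).
- by left; exact: (turn_eqz true).
- by left; exact: (turn_eqz false).
- by right; rewrite -[sigma1]invgK; exact: (turnV false).
Qed.

Lemma B3_eqz_ind (K : B3 -> Prop) :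
  K 1 -> (forall a b, eqz a b -> K b -> K a) ->
  (forall a, K a -> K (Delta * a)) -> (forall b a, K a -> K (rot b * a)) ->
  forall a, K a.
Proof.
move=> K1 Keq KD Kr; elim/B3_ind=> // l a Ka.
have [b [e|e]] := letter_eqz l.
- by apply: (Keq _ (Delta * (rot b * a))); auto; rewrite e mulgA; reflexivity.
- by apply: (Keq _ (rot b * (Delta * a))); auto; rewrite e mulgA; reflexivity.
Qed.

Definition turns (s : seq bool) : B3 := \prod_(b <- s) turn b.

Lemma turns0 : turns [::] = 1.
Proof. by rewrite /turns big_nil. Qed.

Lemma turns_cons b s : turns (b :: s) = turn b * turns s.
Proof. by rewrite /turns big_cons. Qed.

Lemma turns_rcons s b : turns (rcons s b) = turns s * turn b.
Proof. by rewrite /turns big_rcons. Qed.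

Lemma turns_head b s : eqz (Delta * turns (b :: s)) (rot b * turns s).
Proof. by rewrite turns_cons mulgA Delta_turn; reflexivity. Qed.

(** The last turn is [Delta * rot b]. Equal rotations combine into the opposite one, so the turn
    flips; opposite rotations cancel and leave [Delta]. *)
Lemma turns_last s b c :
  eqz (turns (rcons s b) * rot c)
      (if b == c then turns (rcons s (~~ b)) else turns s * Delta).
Proof.
rewrite turns_rcons turn_eqz -!mulgA; case: eqP => [<- | /eqP bc].
  by rewrite rot2_eqz turns_rcons turn_eqz; reflexivity.
have -> : c = ~~ b by case: b c bc => [] [].
by rewrite rotV mulg1; reflexivity.
Qed.

(** An alternating word in [Delta] and rotations: each block [Delta * rot b] is a turn, with
    possibly a stray rotation in front and a stray [Delta] at the end. *)
Definition normal (a : B3) : Prop :=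
  exists s (e : bool),
    eqz a (turns s * Delta ^+ e) \/
    exists b, eqz a (rot b * turns s * Delta ^+ e).

Lemma normalP a : normal a.
Proof.
elim/B3_eqz_ind: a => [|a a' aa' [s [e na]]|a [s [e na]]|b a [s [e na]]].
- by exists [::], false; left; rewrite turns0 mulg1; reflexivity.
- by exists s, e; case: na => [na|[b na]]; [left|right; exists b]; rewrite aa'.
- case: na => [na|[b na]]; last first.
    exists (b :: s), e; left.
    by rewrite na !mulgA turns_cons turn_eqz; reflexivity.
  case: s na => [|b s] na.
    exists [::], (~~ e); left; rewrite na turns0 !mul1g.
    by case: e {na}; rewrite /= ?mulg1 ?Delta2_eqz; reflexivity.
  exists s, e; right; exists b.
  by rewrite na mulgA turns_head; reflexivity.
- case: na => [na|[c na]].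
    by exists s, e; right; exists b; rewrite na mulgA; reflexivity.
  have {}na : eqz (rot b * a) (rot b * rot c * turns s * Delta ^+ e).
    by rewrite na !mulgA; reflexivity.
  exists s, e; case: (eqVneq b c) na => [<-|bc] na.
    by right; exists (~~ b); rewrite na rot2_eqz; reflexivity.
  have cb : c = ~~ b by case: b c bc {na} => [] [].
  by left; rewrite na cb rotV mul1g; reflexivity.
Qed.

(** * Reduction up to conjugacy modulo the centre *)

Definition reduced (a : B3) : Prop :=
  [\/ a = 1, a = Delta, exists b, a = rot b | exists b s, a = turns (b :: s)].

Definition reducible (a : B3) : Prop := exists h c, eqz (a ^ h) c /\ reduced c.

Lemma reducible_eqz a b : eqz a b -> reducible b -> reducible a.
Proof.
move=> ab [h [c [bc rc]]]; exists h, c; split=> //.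
by apply: eqz_trans bc; exact: eqzJ.
Qed.

Lemma reducibleJ a h : reducible (a ^ h) -> reducible a.
Proof. by move=> [k [c rc]]; exists (h * k), c; rewrite conjgM. Qed.

Lemma reducibleC a b : reducible (b * a) -> reducible (a * b).
Proof. by move=> r; apply: (@reducibleJ _ a); rewrite conjgE -mulgA mulKg. Qed.

Lemma reduced_reducible a : reduced a -> reducible a.
Proof. by exists 1, a; rewrite conjg1; split=> //; reflexivity. Qed.

Lemma reducible_turns s : reducible (turns s).
Proof.
apply: reduced_reducible; case: s => [|b s].
  by rewrite turns0; constructor 1.
by constructor 4; exists b, s.
Qed.

(** Both claims are proved together, since they alternate: a final [Delta], moved to the front,
    turns the first turn into a rotation, which moves to the end; a final rotation flips the last
    turn or replaces it by [Delta]. Each round trip shortens [s]. *)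
Lemma reducible_turns_mul n s : size s <= n ->
  reducible (turns s * Delta) /\ forall b, reducible (turns s * rot b).
Proof.
elim: n s => [|n IHn] s.
  rewrite leqn0 size_eq0 => /eqP ->; rewrite turns0; split=> [|b].
    by rewrite mul1g; apply: reduced_reducible; constructor 2.
  by rewrite mul1g; apply: reduced_reducible; constructor 3; exists b.
move=> sn; split.
  case: s sn => [_|b s sn]; first exact: (IHn [::] _).1.
  apply: reducibleC; apply: reducible_eqz (turns_head b s) _; apply: reducibleC.
  exact: (IHn s sn).2.
move=> c; case/lastP: s sn => [_|s b]; first exact: (IHn [::] _).2.
rewrite size_rcons ltnS => sn; apply: reducible_eqz (turns_last s b c) _.
by case: eqP => _; [exact: reducible_turns | exact: (IHn s sn).1].
Qed.

Lemma reducibleP a : reducible a.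
Proof.
have [s [e na]] := normalP a.
have [rD rr] := reducible_turns_mul (leqnn (size s)).
case: na => [na|[b na]]; apply: reducible_eqz na _.
  by case: e => /=; rewrite ?mulg1 //; exact: reducible_turns.
(* The leading rotation moves to the end, where a [Delta] before it completes one more turn. *)
rewrite -mulgA; apply: reducibleC; rewrite -mulgA.
case: e => /=; rewrite ?mul1g //.
apply: (@reducible_eqz _ (turns (rcons s b))); last exact: reducible_turns.
by rewrite turns_rcons turn_eqz; reflexivity.
Qed.

(** * Traces and squares of the reduced forms *)

(** The diagonal bounds give trace at least 2; the last bound keeps the square from being the
    identity. *)
Definition unipositive (A : 'M[int]_2) : Prop :=
  [/\ 1 <= A 0 0, 1 <= A 1 1, 0 <= A 0 1, 0 <= A 1 0 & 1 <= A 0 1 + A 1 0]%R.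

Lemma rho_turn b : rho (turn b) = rho_letter (b, ~~ b).
Proof.
have -> : turn b = (\pi_B3 [:: (b, ~~ b)])%qT by rewrite pi_letter; case: b.
by rewrite rho_pi big_seq1.
Qed.

(** Left multiplication by the image of a turn adds one row to the other. *)
Lemma unipositive_turns b s : unipositive (rho (turns (b :: s))).
Proof.
have turn_pos c : unipositive (rho (turn c)).
  by rewrite rho_turn /unipositive !mxE; case: c; rewrite /= !mxE.
elim: s b => [|c s IHs] b; first by rewrite turns_cons turns0 mulg1.
have [? ? ? ? ?] := IHs c.
rewrite turns_cons rhoM rho_turn /unipositive !mul_mx2E.
by case: b; rewrite /rho_letter /= !mxE /=; split; lia.
Qed.

Lemma rho_Delta :
  rho Delta = (\matrix_(i, j) if i == j then 0 else (-1) ^+ (i == 0))%R.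
Proof.
rewrite Delta.unlock !rhoM !rho_pi !big_seq1.
by apply: mx2P; rewrite !mul_mx2E !mxE /=.
Qed.

Lemma rho_zetaX n : rho (zeta ^+ n) = ((-1) ^+ n)%R.
Proof.
elim: n => [|n IHn]; first by rewrite expg0 rho1.
rewrite expgS rhoM IHn exprS; congr (_ * _)%R.
by rewrite rhoM rho_Delta; apply: mx2P; rewrite !mul_mx2E !mxE.
Qed.

Lemma eqz_rho a b : eqz a b -> rho a = rho b \/ rho a = (- rho b)%R.
Proof.
move=> [m [n /(congr1 rho)]]; rewrite !rhoM !rho_zetaX => e.
have {e} : rho a = (rho b * (-1) ^+ (n + m))%R.
  by rewrite exprD mulrA -e -mulrA -expr2 sqrr_sign mulr1.
by rewrite -signr_odd; case: odd => ->; rewrite /= ?mulrN mulr1; [right|left].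
Qed.

Lemma trace_rhoJ a h : (\tr (rho (a ^ h)%g) = \tr (rho a))%R.
Proof.
by rewrite conjgE !rhoM -mulmxE mxtrace_mulC mulmxE -mulrA -rhoM
           mulgV rho1 mulr1.
Qed.

Lemma trace_rho_rot b : (\tr (rho (rot b)) = 1)%R.
Proof.
case: b; rewrite /= eta.unlock ?invgM.
  have := pi_letter (true, true); have := pi_letter (false, true).
  by move=> /= <- <-; rewrite rhoM !rho_pi !big_seq1 trace_mx2 !mul_mx2E !mxE.
by rewrite rhoM !rho_pi !big_seq1 trace_mx2 !mul_mx2E !mxE.
Qed.

(** Vanishing of the trace survives conjugation and the sign left by [zeta], and [Delta] is the only
    reduced form with trace zero. *)
Lemma trace0_Delta a : (\tr (rho a) = 0)%R -> exists h, eqz (a ^ h) Delta.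
Proof.
move=> ta; have [h [c [ac rc]]] := reducibleP a; exists h.
have tc : (\tr (rho c) = 0)%R.
  move: ta; rewrite -(trace_rhoJ a h).
  by case: (eqz_rho ac) => ->;
    rewrite ?raddfN //= => /eqP; rewrite oppr_eq0 => /eqP.
case: rc tc ac => [->|-> //|[b ->]|[b [s ->]]].
- by rewrite rho1 mxtrace1.
- by rewrite trace_rho_rot.
- have [p00 p11 _ _ _] := unipositive_turns b s.
  by rewrite trace_mx2 => t0; have := lerD p00 p11; rewrite t0.
Qed.

(** Degree modulo 6 excludes [Delta] (3) and the rotations (2 and -2); a nonempty product of turns
    has a square with a nonzero off-diagonal entry. *)
Lemma rho_sqr1 a : (rho a * rho a = 1)%R -> deg a = 0%R -> a = 1.
Proof.
move=> ra da; have [h [c [ac rc]]] := reducibleP a.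
have [k dk] := eqz_deg ac; rewrite degJ da in dk.
have rJ : (rho (a ^ h)%g * rho (a ^ h)%g = 1)%R.
  rewrite -rhoM -conjMg conjgE !rhoM ra mul1r -rhoM mulVg; exact: rho1.
case: rc => [c1|cD|[b cb]|[b [s cs]]].
- apply/eqP; rewrite -(conjg_eq1 a h); apply/eqP.
  by rewrite -c1; apply: eqz_eq ac _; rewrite degJ c1 deg1.
- by move: dk; rewrite cD deg_Delta; lia.
- by move: dk; rewrite cb; case: b {cb}; rewrite /= ?degV deg_eta; lia.
have [p00 p11 p01 p10 p] := unipositive_turns b s.
rewrite -cs in p00 p11 p01 p10 p.
have rc : (rho c * rho c = 1)%R.
  by case: (eqz_rho ac) rJ => ->; rewrite ?mulrNN.
have := congr1 (fun A : 'M[int]_2 => A 0 1)%R rc.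
have := congr1 (fun A : 'M[int]_2 => A 1 0)%R rc.
by rewrite !mul_mx2E !mxE /=; nia.
Qed.

(** * Reversing elements *)

(** With determinant 1, [G * G] is [\tr G *: G - 1], so commuting with it means commuting with
    [\tr G *: G]; the nonzero trace cancels. *)
Lemma commute_sqr_mx2 (R : idomainType) (G A : 'M[R]_2) :
  (\det G = 1 -> \tr G != 0 -> G * G * A = A * (G * G) -> G * A = A * G)%R.
Proof.
move=> dG tG; rewrite Cayley_Hamilton2 dG mulrBl mulrBr mul1r mulr1.
move=> /addIr; rewrite -scalerAl -scalerAr => e.
apply/matrixP=> i j; apply: (mulfI tG).
by have := congr1 (fun B : 'M[R]_2 => B i j) e; rewrite !mxE.
Qed.

Lemma reversing_trace0 a g : a <> 1 -> g * a = a^-1 * g -> (\tr (rho g) = 0)%R.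
Proof.
move=> a1 ga; apply/eqP; apply: contra_notT a1 => tg.
have gaV : g * a^-1 = a * g.
  by apply: (mulIg a); rewrite mulgVK -mulgA ga mulVKg.
have ga' : (rho g * rho a = rho a * rho g)%R.
  apply: commute_sqr_mx2 => //; first exact: det_rho.
  by rewrite -!rhoM -mulgA ga mulgA gaV mulgA.
have aV : rho a = rho a^-1.
  have gV : (rho g * rho g^-1%g = 1)%R by rewrite -rhoM mulgV rho1.
  by rewrite -[LHS]mulr1 -gV mulrA -ga' -rhoM ga rhoM -mulrA gV mulr1.
apply: rho_sqr1; first by rewrite {1}aV -rhoM mulVg rho1.
have := congr1 deg ga; rewrite !degM degV; lia.
Qed.

Lemma conj_DeltaV a : Delta * a * Delta^-1 = Delta^-1 * a * Delta.
Proof.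
apply: (mulgI Delta); apply: (mulIg Delta).
by rewrite !mulgA mulgV mul1g mulgVK -[RHS]mulgA -/zeta -zeta_central.
Qed.

(** [Delta] and [Delta^-1] conjugate alike, differing by a central factor. Hence [Delta^-1] reverses
    the bracket. *)
Lemma bracketV k :
  (bracket Delta k)^-1 = Delta^-1 * bracket Delta k * Delta.
Proof.
rewrite /bracket !mulgA mulVg mul1g !invgM !invgK -!mulgA; congr (_ * _).
by rewrite !mulgA conj_DeltaV.
Qed.

Lemma sqrt_zeta a : a * a = zeta -> exists k, a = k * Delta * k^-1.
Proof.
move=> aa; have ta : (\tr (rho a) = 0)%R.
  have := Cayley_Hamilton2 (rho a); rewrite -rhoM aa -[zeta]expg1 rho_zetaX.
  (* Both sides contain -1, the image of [zeta]; cancelling it leaves [\tr A *: A = 0] for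
     [A = rho a], whose trace is the square of [\tr A]. *)
  rewrite det_rho expr1 -[LHS]add0r => /addIr /(congr1 mxtrace).
  by rewrite mxtraceZ mxtrace0 => /esym/eqP; rewrite mulf_eq0 orbb => /eqP.
have [k ak] := trace0_Delta ta; exists k.
rewrite -(eqz_eq ak); first by rewrite conjgE !mulgA mulgV mul1g mulgK.
have := congr1 deg aa; rewrite degJ -[zeta]expg1 deg_zetaX degM deg_Delta; lia.
Qed.

Lemma eqz_reversing g g' a :
  eqz g g' -> g * a = a^-1 * g -> g' * a = a^-1 * g'.
Proof.
move=> [m [n e]] ga; apply: (mulIg (zeta ^+ n)).
by rewrite -mulgA zetaX_central mulgA -e -mulgA -zetaX_central mulgA ga
           -!mulgA e.
Qed.

Lemma Delta_reversing a :
  Delta * a = a^-1 * Delta -> exists k, a = (bracket Delta k)^-1.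
Proof.
move=> Da; have [|k ak] := @sqrt_zeta (a * Delta).
  by rewrite mulgA -(mulgA a) Da mulgA mulgV mul1g.
exists k; apply: (mulIg Delta).
by rewrite ak /bracket !invgM !invgK !mulgA mulgVK.
Qed.

Theorem corollary4p1 (a : B3) :
  reversible a <->
  a <> 1 /\
  exists k : B3, is_conjugate (bracket (sigma1 * sigma2 * sigma1) k) a.
Proof.
rewrite (_ : sigma1 * sigma2 * sigma1 = Delta); last by rewrite Delta.unlock.
split=> [[a1 [g ga]]|[a1 [k [h ah]]]]; last first.
  split=> //; move: (bracket Delta k) (bracketV k) ah => b bV ->.
  (* This is the reverser [Delta^-1] of the bracket, carried along by [h]. *)
  exists (h * Delta^-1 * h^-1).
  by rewrite !invgM !invgK bV !mulgA !mulgVK.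
have {}ga : g * a = a^-1 * g by rewrite -ga mulgVK.
split=> //; have [h gD] := trace0_Delta (reversing_trace0 a1 ga).
have [|k ak] := @Delta_reversing (a ^ h).
  by apply: eqz_reversing gD _; rewrite -conjMg ga conjMg conjVg.
(* [a ^ h] is the inverse of a bracket; the factor [Delta^-1] conjugates the bracket to that
   inverse. *)
exists k, (h * Delta^-1).
have -> : a = h * a ^ h * h^-1 by rewrite conjgE !mulgA mulgV mul1g mulgK.
by rewrite ak bracketV !invgM !invgK !mulgA.
Qed.
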